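(* Let $G$ be a finite digraph and let $\mathcal{M}_V=(V_G,\mathcal{I}_V)$ be a matroid on $V_G$. Then the contraction–restoration algorithm for the cardinality matroid branching problem described in the context is correct: for every execution of the algorithm on $(G,\mathcal{M}_V)$ (that is, for all choices of nodes and arcs it makes), the output $\widehat B^0$ is a matroid branching in $G$ with respect to $\mathcal{M}_V$ of maximum cardinality $|\widehat B^0|$ among all matroid branchings in $G$ with respect to $\mathcal{M}_V$.
   Context: A digraph $G$ has a finite node set $V_G$ and a finite arc set $A_G$; each arc has a tail and a head, and distinct arcs may be parallel. For $X\subseteq V_G$: $\delta^{\rm in}(X)$ (resp. $\delta^{\rm out}(X)$) is the set of arcs entering (resp. leaving) $X$, and $\gamma(X)$ is the set of arcs with both endpoints in $X$. A branching in $G$ is a set $B\subseteq A_G$ such that the underlying undirected graph spanned by $B$ is acyclic and each node of $G$ is entered (covered) by at most one arc of $B$. For $B\subseteq A_G$, $C(B)$ denotes the set of nodes entered by an arc of $B$. A matroid branching in $G$ w.r.t. $\mathcal{M}_V=(V_G,\mathcal{I}_V)$ is a branching $B$ with $C(B)\in\mathcal{I}_V$. Contraction of a digraph: for nonempty $Q\subseteq V_G$, $G/Q$ is obtained from $G$ by removing all nodes of $Q$, adding one new (composite) node $\overline{Q}$, removing all arcs of $\gamma(Q)$, changing to $\overline Q$ the heads of all arcs in $\delta^{\rm in}(Q)$ and the tails of all arcs in $\delta^{\rm out}(Q)$, and keeping all other arcs unchanged. Arcs of $G/Q$ are identified with the corresponding arcs in $A_G\setminus\gamma(Q)$. Contraction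 of a matroid (not the usual notion): for a matroid $\mathcal{M}=(E,\mathcal{I})$ and nonempty $Q\subseteq E$, $\mathcal{M}/Q$ has ground set $E' := (E\setminus Q)\cup\{\overline Q\}$. A set $X\subseteq E'\setminus\{\overline Q\}$ is independent in $\mathcal{M}/Q$ iff there is $q\in Q$ with $X\cup (Q\setminus\{q\})\in\mathcal{I}$; a set $X\subseteq E'$ with $\overline Q\in X$ is independent in $\mathcal{M}/Q$ iff $(X\setminus\{\overline Q\})\cup Q\in\mathcal{I}$. The algorithm. Contraction phase. Start with $G^0:=G$, $\mathcal{M}_V^0:=\mathcal{M}_V$, $B^0:=\emptyset$. At step $i$, given a digraph $G^i$, a matroid $\mathcal{M}_V^i$ on $V_{G^i}$ and a matroid branching $B^i$ in $G^i$ w.r.t. $\mathcal{M}_V^i$, let $U$ be the set of nodes of $G^i$ having at least one incoming arc in $G^i$, and $W:=U\setminus C(B^i)$. If $C(B^i)\cup\{v\}$ is dependent w.r.t. $\mathcal{M}_V^i$ for all $v\in W$, the phase stops, with $N:=i$. Otherwise choose arbitrarily $v\in W$ with $C(B^i)\cup\{v\}$ independent w.r.t. $\mathcal{M}_V^i$, and an arbitrary arc $a$ of $G^i$ entering $v$. (a) If $B^i\cup\{a\}$ spans no cycle, put $G^{i+1}:=G^i$, $\mathcal{M}_V^{i+1}:=\mathcal{M}_V^i$, $B^{i+1}:=B^i\cup\{a\}$. (b) Otherwise let $K^i$ be the cycle in $B^i\cup\{a\}$ and $Z^i$ its node set; put $G^{i+1}:=G^i/Z^i$, $\mathcal{M}_V^{i+1}:=\mathcal{M}_V^i/Z^i$,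 $B^{i+1}:=B^i\setminus\gamma(Z^i)$. Restoration phase. Put $\widehat B^N:=B^N$. For $i=N,N-1,\dots,1$ define $\widehat B^{i-1}$ from $\widehat B^i$ as follows. If the passage from $G^{i-1}$ to $G^i$ was of type (a), put $\widehat B^{i-1}:=\widehat B^i$. If it was of type (b) (contraction of $Z^{i-1}$ to the composite node $\overline{Z^{i-1}}$ of $G^i$): – if no arc of $\widehat B^i$ enters $\overline{Z^{i-1}}$, choose a node $w\in Z^{i-1}$ such that $C(\widehat B^i)\cup (Z^{i-1}\setminus\{w\})$ is independent w.r.t. $\mathcal{M}_V^{i-1}$, let $a$ be the arc of $K^{i-1}$ entering $w$; – if an arc $b\in\widehat B^i$ enters $\overline{Z^{i-1}}$, let $a$ be the unique arc of $K^{i-1}$ having the same head in $G^{i-1}$ as $b$. In both cases put $\widehat B^{i-1}:=\widehat B^i\cup (A_{K^{i-1}}\setminus\{a\})$. The output is $\widehat B^0$. *)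

(* Defs.v *)
From mathcomp Require Import all_boot.
From Stdlib Require Import Relation_Operators.

Set Implicit Arguments.
Unset Strict Implicit.
Unset Printing Implicit Defensive.

(* The arc set is a subset of a fixed finite type [A], so that the arcs of a  *)
(* contracted digraph are literally arcs of the original one; [tail] and      *)
(* [head] are irrelevant outside [arcs].  Parallel arcs and loops are allowed.*)
Record digraph (A : finType) := Digraph {
  node :> finType;
  arcs : {set A};
  tail : A -> node;
  head : A -> node
}.

Section Branchings.

Variables (A : finType) (G : digraph A).
Implicit Types (x y : G) (X Z : {set G}) (a : A) (B K : {set A}).

Definition inner_arcs X : {set A} :=
  [set a in arcs G | (tail G a \in X) && (head G a \in X)].

Definition covered B : {set G} := [set head G a | a in B].

Definition joins a x y : bool :=
  ((tail G a == x) && (head G a == y)) || ((tail G a == y) && (head G a == x)).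

(* Walks of the underlying undirected multigraph: [:: (a1, x1); (a2, x2); ...]*)
(* traverses a1 from x to x1, then a2 from x1 to x2, and so on.               *)
Fixpoint uwalk x (p : seq (A * G)) : bool :=
  if p is (a, y) :: p' then joins a x y && uwalk y p' else true.

(* A loop is a cycle of length 1, two parallel or opposite arcs form a cycle  *)
(* of length 2.                                                               *)
Definition is_cycle K Z : Prop :=
  exists x p,
    [/\ p != [::], uwalk x p, last x (unzip2 p) = x,
        uniq (unzip1 p) & uniq (unzip2 p)] /\
    K = [set a in unzip1 p] /\ Z = [set y in unzip2 p].

Definition acyclic B : Prop :=
  forall K Z, is_cycle K Z -> ~~ (K \subset B).

Definition branching B : Prop :=
  [/\ B \subset arcs G, acyclic B
    & forall x, #|[set a in B | head G a == x]| <= 1].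

Definition matroid_branching (I : {set {set G}}) B : Prop :=
  branching B /\ covered B \in I.

Definition max_matroid_branching (I : {set {set G}}) B : Prop :=
  matroid_branching I B /\
  forall B', matroid_branching I B' -> #|B'| <= #|B|.

End Branchings.

Record is_matroid (T : finType) (I : {set {set T}}) : Prop := IsMatroid {
  indep0 : set0 \in I;
  indepS : forall X Y : {set T}, X \subset Y -> Y \in I -> X \in I;
  indep_augment : forall X Y : {set T}, X \in I -> Y \in I -> #|X| < #|Y| ->
    exists2 y, y \in Y :\: X & y |: X \in I
}.

(* Ground set after contracting Q: [None] is the composite node, and [Some x] *)
(* is the remaining element x.                                                *)
Definition quot (T : finType) (Q : {set T}) : finType :=
  option {x : T | x \notin Q}.

(* [insub] sends x to [Some x] if x is not in Q, and to [None] otherwise.     *)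
Definition to_quot (T : finType) (Q : {set T}) (x : T) : quot Q := insub x.

Definition from_quot (T : finType) (Q : {set T}) (X : {set quot Q}) : {set T} :=
  [set x | (x \notin Q) && (to_quot Q x \in X)].

Definition contract_matroid (T : finType) (I : {set {set T}}) (Q : {set T}) :
    {set {set quot Q}} :=
  [set X : {set quot Q} |
    if None \in X then from_quot X :|: Q \in I
    else [exists q in Q, from_quot X :|: (Q :\ q) \in I]].

Definition contract (A : finType) (G : digraph A) (Q : {set G}) : digraph A :=
  {| node := quot Q;
     arcs := arcs G :\: inner_arcs Q;
     tail := fun a => to_quot Q (tail G a);
     head := fun a => to_quot Q (head G a) |}.

Section Algorithm.

Variable A : finType.

(* The triple (G^i, M_V^i, B^i) of the contraction phase. *)
Record state := State {
  st_graph : digraph A;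
  st_indep : {set {set st_graph}};
  st_arcs : {set A}
}.

(* W: the uncovered nodes having an incoming arc (possibly a loop). *)
Definition candidates (s : state) : {set st_graph s} :=
  [set head (st_graph s) a | a in arcs (st_graph s)]
    :\: covered (st_graph s) (st_arcs s).

(* Node v of W and arc a entering v that may be chosen in state s. *)
Definition eligible (s : state) (v : st_graph s) (a : A) : Prop :=
  [/\ v \in candidates s,
      v |: covered (st_graph s) (st_arcs s) \in st_indep s,
      a \in arcs (st_graph s) & head (st_graph s) a = v].

(* What the restoration phase needs about a step of type (b): G^i, M_V^i,     *)
(* K^i and Z^i.                                                               *)
Record contraction := Contraction {
  ct_graph : digraph A;
  ct_indep : {set {set ct_graph}};
  ct_arcs : {set A};
  ct_nodes : {set ct_graph}
}.

(* One entry per step of the contraction phase, latest step first; [None]     *)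
(* stands for a step of type (a).                                             *)
Definition history := seq (option contraction).

Definition enters_composite (c : contraction) (b : A) : Prop :=
  head (contract (ct_nodes c)) b = None.

(* [omitted c Bh a]: a may be the arc of the cycle left out when Bh is        *)
(* extended across the contraction c.                                         *)
Inductive omitted (c : contraction) (Bh : {set A}) (a : A) : Prop :=
| OmitFree (w : ct_graph c) of
    (forall b, b \in Bh -> ~ enters_composite c b) &
    w \in ct_nodes c &
    covered (ct_graph c) Bh :|: (ct_nodes c :\ w) \in ct_indep c &
    a \in ct_arcs c & head (ct_graph c) a = w
| OmitEntered (b : A) of
    b \in Bh & enters_composite c b &
    a \in ct_arcs c & head (ct_graph c) a = head (ct_graph c) b.

(* [Contracting h s]: contraction phase at step [size h], in state s.         *)
(* [Restoring h Bh]: restoration phase with Bh the arc set of index [size h]. *)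
Inductive config :=
| Contracting of history & state
| Restoring of history & {set A}.

Inductive step : config -> config -> Prop :=
| StepAdd h s (v : st_graph s) a of eligible v a &
    acyclic (st_graph s) (a |: st_arcs s) :
    step (Contracting h s)
         (Contracting (None :: h) (State (st_indep s) (a |: st_arcs s)))
| StepContract h s (v : st_graph s) a K (Z : {set st_graph s}) of eligible v a &
    is_cycle K Z & K \subset a |: st_arcs s :
    step (Contracting h s)
         (Contracting (Some (Contraction (st_indep s) K Z) :: h)
            (@State (contract Z) (contract_matroid (st_indep s) Z)
                    (st_arcs s :\: inner_arcs Z)))
| StepStop h s of
    (forall v, v \in candidates s ->
       v |: covered (st_graph s) (st_arcs s) \notin st_indep s) :
    step (Contracting h s) (Restoring h (st_arcs s))
| StepRestoreAdd h Bh :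
    step (Restoring (None :: h) Bh) (Restoring h Bh)
| StepRestoreContract c h Bh a of omitted c Bh a :
    step (Restoring (Some c :: h) Bh)
         (Restoring h (Bh :|: (ct_arcs c :\ a))).

Definition start (G : digraph A) (I : {set {set G}}) : config :=
  Contracting [::] (State I set0).

Definition output (Bh : {set A}) : config := Restoring [::] Bh.

Definition execution : config -> config -> Prop := clos_refl_trans_1n _ step.

End Algorithm.

(* Main.v *)
(* An arc set in which every node has at most one entering arc is acyclic iff *)
(* it admits a ranking, a map r on the nodes with r (tail a) < r (head a), and*)
(* a cycle in which all heads differ is a directed cycle covering exactly its *)
(* nodes.  The cycle nodes Z found by the algorithm thus lie in the           *)
(* independent set C(B) + v.  For such a Z the optimum of G exceeds that of   *)
(* G/Z by exactly |Z| - 1.  One direction is the restoration step.  For the   *)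
(* other, take a branching B of G and a node z of Z of minimum rank, extend   *)
(* Z - z by elements Y of C(B) to an independent set of size at least |B|, and*)
(* keep the arcs of B entering Y: at most one of them enters Z, and it starts *)
(* at a node of rank lower than all of Z, so that they form a branching of    *)
(* G/Z.  When the contraction phase stops, C(B) is a largest independent set  *)
(* of nodes with an incoming arc, so B is optimal, and optimality is carried  *)
(* back through the contractions.                                             *)

From mathcomp Require Import all_boot zify.
From Stdlib Require Import Classical Relation_Operators.
Require Import Defs.

Set Implicit Arguments.
Unset Strict Implicit.
Unset Printing Implicit Defensive.

(** Rankings ([branchingP]) replace acyclicity: they pass to a contracted digraph, and they combine
    lexicographically when a cycle is restored. The core is that contracting an independent cycle
    set Z lowers the optimum by exactly |Z| - 1: [matroid_branching_contract] gives the upper bound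
    for G, [matroid_branching_restore] attains it, and [max_restore] combines them. At the stop,
    augmentation makes the current branching optimal ([stop_max]).

    The contraction phase thus only has to preserve a matroid and a matroid branching
    ([contract_is_matroid], [add_matroid_branching], [contract_state_branching]), while [restorable]
    records that optimality can be pulled back level by level. Termination holds because 2|A| - |B|
    drops with each arc added or cycle contracted. *)

(** * Extension of independent sets *)

Section Matroids.

Variables (T : finType) (I : {set {set T}}).
Hypothesis matI : is_matroid I.

(** Iterated augmentation. The added part [Y] is kept apart, since it later selects the arcs to
    keep. *)
Lemma matroid_extend (X C : {set T}) : X \in I -> C \in I ->
  exists Y : {set T}, [/\ Y \subset C :\: X, X :|: Y \in I & #|C| <= #|X| + #|Y|].
Proof.
have [n] := ubnP (#|C| - #|X|); elim: n X => // n IHn X le_n XI CI.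
have [leCX|ltXC] := leqP #|C| #|X|.
  exists set0; rewrite sub0set setU0 cards0 addn0; split=> //.
have [y] := indep_augment matI XI CI ltXC.
rewrite inE => /andP[yX yC] yXI.
have cardyX : #|y |: X| = #|X|.+1 by rewrite cardsU1 yX.
have [|Y [sYC YI leC]] := IHn (y |: X) _ yXI CI.
  by rewrite cardyX; lia.
have yY : y \notin Y.
  by apply/negP=> /(subsetP sYC); rewrite !inE eqxx.
exists (y |: Y); split.
- apply/subsetP=> u; rewrite !inE => /orP[/eqP->|/(subsetP sYC)].
    by rewrite yX yC.
  by rewrite !inE negb_or => /andP[/andP[_ ->] ->].
- by rewrite setUCA setUA.
- by rewrite cardsU1 yY addnA addn1 -cardyX.
Qed.

End Matroids.

(** * Sets with Q shrunk to a point *)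

Section Quotient.

Variables (T : finType) (Q : {set T}).
Implicit Types (x y : T) (X : {set quot Q}).

Lemma to_quot_eq_None x : (to_quot Q x == None) = (x \in Q).
Proof. by rewrite /to_quot; case: insubP => [u /negbTE-> _|/negbNE->]. Qed.

Lemma to_quot_inj x y : x \notin Q -> to_quot Q x = to_quot Q y -> x = y.
Proof.
rewrite /to_quot => xQ; rewrite insubT; case: insubP => // u yQ <- [<-].
by [].
Qed.

Lemma to_quotK (x : {x : T | x \notin Q}) : to_quot Q (val x) = Some x.
Proof. by rewrite /to_quot valK. Qed.

Lemma mem_from_quot X x : (x \in from_quot X) = (x \notin Q) && (to_quot Q x \in X).
Proof. by rewrite inE. Qed.

Lemma card_from_quot X : #|X| = (None \in X) + #|from_quot X|.
Proof.
rewrite (cardsD1 None); congr (_ + _).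
have <- : to_quot Q @: from_quot X = X :\ None.
  apply/setP=> u; apply/imsetP/idP.
    case=> x; rewrite mem_from_quot => /andP[xQ xX] ->.
    by rewrite !inE to_quot_eq_None xQ xX.
  rewrite !inE; case: u => [u|//] /= uX; exists (val u).
    by rewrite mem_from_quot to_quotK uX (valP u).
  by rewrite to_quotK.
apply: card_in_imset => x y; rewrite mem_from_quot => /andP[xQ _] _.
exact: to_quot_inj.
Qed.

Lemma from_quotS X X' : X \subset X' -> from_quot X \subset from_quot X'.
Proof.
move=> /subsetP sXX'; apply/subsetP=> x; rewrite !mem_from_quot.
by case/andP=> -> /sXX'->.
Qed.

End Quotient.

(** * The contracted matroid *)

Section MatroidContraction.

Variables (T : finType) (I : {set {set T}}) (Z : {set T}).
Hypotheses (matI : is_matroid I) (ZI : Z \in I) (Z0 : Z != set0).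

Lemma from_quotU1 (X : {set quot Z}) e : e \notin Z ->
  from_quot (to_quot Z e |: X) = e |: from_quot X.
Proof.
move=> eZ; apply/setP=> x; rewrite !inE.
have [->|nxe] := eqVneq x e; first by rewrite eZ eqxx.
have [//|xZ] := boolP (x \in Z); have [/(to_quot_inj xZ) xe|//] := eqVneq.
by rewrite xe eqxx in nxe.
Qed.

Lemma from_quotU1None (X : {set quot Z}) : from_quot (None |: X) = from_quot X.
Proof.
by apply/setP=> x; rewrite !inE to_quot_eq_None; case: (x \in Z).
Qed.

(** Gives both cases of independence one shape, so that monotonicity and counting treat them alike;
    [q] is arbitrary when [None] is in [X]. *)
Lemma contract_matroidP (X : {set quot Z}) :
  reflect (exists2 q, None \notin X -> q \in Z &
             from_quot X :|: (if None \in X then Z else Z :\ q) \in I)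
          (X \in contract_matroid I Z).
Proof.
rewrite inE; case: ifP => NX; last first.
  by apply: (iffP exists_inP) => [] [q qZ XI]; exists q; auto.
apply: (iffP idP) => [XI|[]//].
by case/set0Pn: Z0 => z _; exists z.
Qed.

(* The witnesses from_quot X :|: Z and from_quot X :|: (Z :\ q) all have       *)
(* #|X| + #|Z| - 1 elements, so augmentation can be done in I; the element q  *)
(* may have to be exchanged once before an element outside Z is obtained.     *)
Lemma contract_is_matroid : is_matroid (contract_matroid I Z).
Proof.
split.
- case/set0Pn: Z0 => z zZ; apply/contract_matroidP; exists z => //.
  rewrite inE; apply: (indepS matI) ZI; rewrite subUset subsetDl andbT.
  by apply/subsetP=> x; rewrite mem_from_quot inE andbF.
- move=> X Y sXY /contract_matroidP[q qZ YI]; have sfXY := from_quotS sXY.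
  case NX: (None \in X).
    apply/contract_matroidP; exists q; rewrite ?NX //.
    rewrite (subsetP sXY) // in YI; apply: (indepS matI) YI; exact: setSU.
  case/set0Pn: Z0 => z zZ.
  apply/contract_matroidP; exists (if None \in Y then z else q).
    by case: ifP qZ => // _ ->.
  rewrite NX; apply: (indepS matI) YI; apply: setUSS => //.
  by case: ifP => // _; apply: subsetDl.
move=> X Y /contract_matroidP[q qZ XI] /contract_matroidP[q' q'Z YI] ltXY.
have disjZ (X' : {set quot Z}) (W : {set T}) : W \subset Z ->
    #|from_quot X' :|: W| = #|from_quot X'| + #|W|.
  move=> sWZ; rewrite cardsU [_ :&: _](_ : _ = set0) ?cards0 ?subn0 //.
  apply/setP=> x; rewrite !inE; apply/negP=> /andP[/andP[/negP xZ _]].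
  by move/(subsetP sWZ).
have cardX (X' : {set quot Z}) r : (None \notin X' -> r \in Z) ->
    #|from_quot X' :|: (if None \in X' then Z else Z :\ r)|.+1 = #|X'| + #|Z|.
  move=> rZ; rewrite (card_from_quot X'); case: ifP rZ => _ rZ.
    by rewrite disjZ // addnA.
  by rewrite disjZ ?subsetDl // (cardsD1 r Z) rZ // addnS.
have ltXY' : #|from_quot X :|: (if None \in X then Z else Z :\ q)| <
             #|from_quot Y :|: (if None \in Y then Z else Z :\ q')|.
  by rewrite -ltnS !cardX // ltn_add2r.
have sZ (b : bool) r : (if b then Z else Z :\ r) \subset Z.
  by case: b => //; apply: subsetDl.
have outside e r : (None \notin X -> r \in Z) -> e \notin Z ->
    e \in (from_quot Y :|: (if None \in Y then Z else Z :\ q'))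
        :\: (from_quot X :|: (if None \in X then Z else Z :\ r)) ->
    e |: (from_quot X :|: (if None \in X then Z else Z :\ r)) \in I ->
    exists2 y, y \in Y :\: X & y |: X \in contract_matroid I Z.
  move=> rZ eZ eYX eXI; exists (to_quot Z e).
    move: eYX; rewrite inE !in_setU !mem_from_quot eZ /= !negb_or => /andP[/andP[eX _]].
    by case/orP=> [eY|/(subsetP (sZ _ _))]; [rewrite inE eX | rewrite (negbTE eZ)].
  have NeX : (None \in to_quot Z e |: X) = (None \in X).
    by rewrite !inE eq_sym to_quot_eq_None (negbTE eZ).
  apply/contract_matroidP; exists r; rewrite NeX //.
  by rewrite from_quotU1 // -setUA.
have [e eYX eXI] := indep_augment matI XI YI ltXY'.
have [eZ|] := boolP (e \in Z); last by move=> eZ; apply: (outside e q).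
have NX : None \notin X.
  by apply/negP=> NX; move: eYX; rewrite NX !inE eZ orbT.
have eq_eq : e = q.
  move: eYX; rewrite (negbTE NX) !inE eZ /= andbT negbK.
  by case/andP=> /eqP.
have XZI : from_quot X :|: Z \in I.
  move: eXI; rewrite (negbTE NX) eq_eq setUCA setD1K ?qZ //.
have [NY|NY] := boolP (None \in Y).
  exists None; first by rewrite inE NX.
  apply/contract_matroidP; exists q; first by rewrite setU11.
  by rewrite setU11 from_quotU1None.
(* Since all of [Z] fits with [X], the omitted element may be changed to [q']. Both witnesses then
   agree on [Z], which forces the next augmenting element outside [Z]. *)
have XI' : from_quot X :|: (if None \in X then Z else Z :\ q') \in I.
  by apply: (indepS matI) XZI; apply: setUS.
have [|e' e'YX e'XI] := indep_augment matI XI' YI.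
  by rewrite -ltnS !cardX ?ltn_add2r // => _; apply: q'Z.
apply: (outside e' q') => //; first by move=> _; apply: q'Z.
apply/negP=> e'Z; move: e'YX; rewrite (negbTE NX) (negbTE NY) !inE e'Z /=.
by rewrite andbT; case: (e' == q').
Qed.

End MatroidContraction.

(** * Cycles, rankings and acyclicity *)

Section Cycles.

Variables (A : finType) (G : digraph A).
Implicit Types (x y : G) (Z : {set G}) (a : A) (B K : {set A}).

Lemma joinsP a x y :
  reflect ((tail G a = x /\ head G a = y) \/ (tail G a = y /\ head G a = x))
          (joins a x y).
Proof.
apply: (iffP orP) => [] [].
- by case/andP=> /eqP-> /eqP->; left.
- by case/andP=> /eqP-> /eqP->; right.
- by case=> -> ->; left; rewrite !eqxx.
- by case=> -> ->; right; rewrite !eqxx.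
Qed.

Lemma uwalk_cat x (p q : seq (A * G)) :
  uwalk x (p ++ q) = uwalk x p && uwalk (last x (unzip2 p)) q.
Proof. by elim: p x => [|[a y] p IHp] x //=; rewrite IHp andbA. Qed.

Lemma uwalk_ends x (p : seq (A * G)) a : uwalk x p -> a \in unzip1 p ->
  (tail G a \in x :: unzip2 p) /\ (head G a \in x :: unzip2 p).
Proof.
elim: p x => [|[b y] p IHp] x //= /andP[/joinsP ends_b walk_p].
rewrite !(inE, in_cons) => /orP[/eqP->|/(IHp _ walk_p)[]].
  by case: ends_b => [] [-> ->]; rewrite !eqxx !orbT.
by rewrite !inE => -> ->; rewrite !orbT.
Qed.

Lemma cycle_ends K Z a : is_cycle K Z -> a \in K ->
  (tail G a \in Z) /\ (head G a \in Z).
Proof.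
case=> x [p [[p0 walk_p last_p _ _] [-> ->]]]; rewrite !inE => /(uwalk_ends walk_p).
have xp : x \in unzip2 p.
  by rewrite -{1}last_p; case: p p0 {walk_p last_p} => [|[a0 x0] p] //= _; apply: mem_last.
by rewrite !in_cons; case=> [] /predU1P[->|->] /predU1P[->|->].
Qed.

Lemma cycle_card K Z : is_cycle K Z -> #|K| = #|Z| /\ Z != set0.
Proof.
case=> x [p [[p0 _ _ up1 up2] [-> ->]]]; split.
  by rewrite !cardsE !(card_uniqP _) // !size_map.
apply/set0Pn; case: p p0 {up1 up2} => [|[a y] p] //= _.
by exists y; rewrite !inE eqxx.
Qed.

(** The heads are |K| = |Z| distinct nodes of Z, hence all of Z. *)
Lemma cycle_covered K Z : is_cycle K Z -> {in K &, injective (head G)} ->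
  covered G K = Z.
Proof.
move=> cKZ injK; apply/eqP; rewrite eqEcard card_in_imset // (cycle_card cKZ).1.
rewrite leqnn andbT; apply/subsetP=> _ /imsetP[a aK ->].
by case: (cycle_ends cKZ aK).
Qed.

Lemma cycle_inner K Z : is_cycle K Z -> K \subset arcs G -> K \subset inner_arcs Z.
Proof.
move=> cKZ /subsetP sKA; apply/subsetP=> a aK.
by rewrite inE sKA //; have [-> ->] := cycle_ends cKZ aK.
Qed.

Definition ranking (r : G -> nat) B : Prop :=
  {in B, forall a, r (tail G a) < r (head G a)}.

(** A node of minimum rank on a cycle would be entered by a cycle arc whose tail has lower rank. *)
Lemma ranking_acyclic B r :
  {in B &, injective (head G)} -> ranking r B -> acyclic G B.
Proof.
move=> injB rB K Z cKZ; apply/negP=> /subsetP sKB.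
have covK := cycle_covered cKZ (sub_in2 sKB injB).
have [_ /set0Pn[z0 z0Z]] := cycle_card cKZ.
case: (arg_minnP r z0Z) => z zZ minz.
move: (zZ); rewrite -covK => /imsetP[a aK z_a].
have := rB _ (sKB _ aK); rewrite -z_a ltnNge minz //.
by case: (cycle_ends cKZ aK).
Qed.

Definition parent B : rel G :=
  fun x y => [exists a in B, (tail G a == x) && (head G a == y)].

Lemma parent_walk B x (p : seq G) : path (parent B) x p ->
  exists q : seq (A * G), [/\ uwalk x q, unzip2 q = p,
    map (head G) (unzip1 q) = p & {subset unzip1 q <= B}].
Proof.
elim: p x => [|y p IHp] x /=; first by exists [::].
case/andP=> /exists_inP[a aB /andP[/eqP ta /eqP ha]] /IHp[q [wq q2 q1 qB]].
exists ((a, y) :: q) => /=; rewrite /joins ta ha !eqxx wq q1 q2; split=> // b.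
by rewrite inE => /orP[/eqP->|/qB].
Qed.

(* The rank of a node is the number of its ancestors. *)
Lemma acyclic_ranking B : acyclic G B -> exists r, ranking r B.
Proof.
move=> acB; exists (fun x => #|[set y | connect (parent B) y x]|) => a aB.
have par_a : parent B (tail G a) (head G a).
  by apply/exists_inP; exists a => //; rewrite !eqxx.
apply/proper_card/properP; split.
  apply/subsetP=> y; rewrite !inE => /connect_trans-> //; exact: connect1.
(* If the head of [a] were an ancestor of its tail, a simple directed path between them would close
   up with [a] to a cycle. *)
exists (head G a); rewrite inE ?connect0 //; apply/negP=> /connectP[p path_p].
case/shortenP: path_p => p' path_p' up' _ last_p'.
have [q [wq q2 q1 qB]] := parent_walk path_p'.
have walk_q : uwalk (head G a) (rcons q (a, head G a)).
  rewrite -cats1 uwalk_cat wq q2 -last_p' /= andbT.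
  by apply/joinsP; left.
have heads_q : map (head G) (rcons (unzip1 q) a) = rcons p' (head G a).
  by rewrite map_rcons q1.
have u_p' : uniq (rcons p' (head G a)) by rewrite rcons_uniq.
have /acB/negP[] : is_cycle [set b in unzip1 (rcons q (a, head G a))]
                            [set y : G in unzip2 (rcons q (a, head G a))].
  exists (head G a), (rcons q (a, head G a)); split=> //; split=> //.
  - by case: (q).
  - by rewrite /unzip2 map_rcons last_rcons.
  - by rewrite /unzip1 map_rcons; apply: (@map_uniq _ _ (head G)); rewrite heads_q.
  - by rewrite /unzip2 map_rcons -/(unzip2 q) q2.
apply/subsetP=> b; rewrite inE /unzip1 map_rcons mem_rcons inE.
by case/predU1P=> [->|/qB].
Qed.

Lemma branchingP B :
  branching G B <->
  [/\ B \subset arcs G, {in B &, injective (head G)} & exists r, ranking r B].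
Proof.
split=> [[sBA acB inB]|[sBA injB [r rB]]]; split=> //.
- move=> a b aB bB hab; apply: (card_le1_eqP (inB (head G b)));
    by rewrite !inE ?aB ?bB ?hab eqxx.
- exact: acyclic_ranking.
- exact: ranking_acyclic rB.
- move=> x; apply/card_le1_eqP=> a b; rewrite !inE.
  by case/andP=> aB /eqP ha /andP[bB /eqP hb]; apply: injB; rewrite // ha.
Qed.

Lemma card_covered B : branching G B -> #|covered G B| = #|B|.
Proof. by case/branchingP=> _ injB _; apply: card_in_imset. Qed.

(* A walk no arc of which enters its first node is a directed path; the rank  *)
(* of a node is its position.                                                 *)
Lemma uwalk_forward x (q : seq (A * G)) a :
    uwalk x q -> uniq (x :: unzip2 q) -> uniq (map (head G) (unzip1 q)) ->
    x \notin map (head G) (unzip1 q) -> a \in unzip1 q ->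
  index (tail G a) (x :: unzip2 q) < index (head G a) (x :: unzip2 q).
Proof.
elim: q x => [|[b y] q IHq] x //= /andP[/joinsP ends_b walk_q] /andP[x_q uq].
case/andP=> hb uhq; rewrite inE negb_or => /andP[xhb _].
case: ends_b => [] [tb hb_y]; last by rewrite hb_y eqxx in xhb.
rewrite inE => /orP[/eqP->|aq].
  by rewrite tb hb_y !eqxx; case: ifP x_q => // /eqP->; rewrite inE eqxx.
have [ta ha] := uwalk_ends walk_q aq.
have nx u : u \in y :: unzip2 q -> (x == u) = false.
  by move=> uq'; apply/negbTE; apply: contraNneq x_q => ->.
by rewrite !nx // ltnS; apply: IHq; rewrite // -hb_y.
Qed.

Lemma uwalk_backward x (q : seq (A * G)) a :
    uwalk x q -> uniq (x :: unzip2 q) -> uniq (map (head G) (unzip1 q)) ->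
    last x (unzip2 q) \notin map (head G) (unzip1 q) -> a \in unzip1 q ->
  index (head G a) (x :: unzip2 q) < index (tail G a) (x :: unzip2 q).
Proof.
elim/last_ind: q => [|q [b y] IHq] //.
rewrite /unzip1 /unzip2 !map_rcons -!/(unzip1 q) -!/(unzip2 q) last_rcons.
rewrite -[rcons q _]cats1 uwalk_cat => /andP[walk_q].
rewrite [uwalk _ [:: _]]/= andbT => /joinsP ends_b.
rewrite -rcons_cons !rcons_uniq => uq /andP[hb uhq].
case/andP: uq => y_q uq; rewrite !mem_rcons !inE negb_or => /andP[yhb _].
case: ends_b => [] [tb hb_u]; first by rewrite hb_u eqxx in yhb.
have idx u : u \in x :: unzip2 q ->
    index u (rcons (x :: unzip2 q) y) = index u (x :: unzip2 q).
  by move=> u_q; rewrite -cats1 index_cat u_q.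
case/orP=> [/eqP->|aq].
  rewrite hb_u tb idx ?mem_last // -cats1 index_cat (negbTE y_q).
  by rewrite [index y [:: y]]/= eqxx addn0 index_mem mem_last.
have [ta ha] := uwalk_ends walk_q aq.
by rewrite !idx //; apply: IHq; rewrite // -hb_u.
Qed.

(** Cut open at [a], the cycle becomes a walk between the ends of [a]. No remaining arc enters the
    head of [a], so the walk is directed away from that end. *)
Lemma cycle_ranking K Z a :
    is_cycle K Z -> {in K &, injective (head G)} -> a \in K ->
  exists r, ranking r (K :\ a).
Proof.
case=> x [p [[_ walk_p last_p up1 up2] [def_K _]]] injK.
rewrite {1}def_K inE => /mapP[[a' y] ay_p /= def_a]; rewrite -{a'}def_a in ay_p.
case/splitPr: ay_p => p1 p2 in walk_p last_p up1 up2 def_K *.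
move: walk_p last_p up1 up2; rewrite uwalk_cat /= => /and3P[w1 join_a w2].
rewrite /unzip2 /unzip1 !map_cat /= -!/(unzip1 _) -!/(unzip2 _) last_cat /= => last_p.
have catC (S : eqType) (s1 s2 : seq S) z : perm_eq (s1 ++ z :: s2) (z :: s2 ++ s1).
  by rewrite -cat_cons perm_catC.
rewrite !(perm_uniq (catC _ _ _ _)) => up1 up2.
pose q := p2 ++ p1; have q1 : unzip1 q = unzip1 p2 ++ unzip1 p1 by apply: map_cat.
have q2 : unzip2 q = unzip2 p2 ++ unzip2 p1 by apply: map_cat.
have walk_q : uwalk y q by rewrite uwalk_cat w2 last_p.
have last_q : last y (unzip2 q) = last x (unzip2 p1) by rewrite q2 last_cat last_p.
rewrite -q1 -q2 in up1 up2.
have mem_p : unzip1 (p1 ++ (a, y) :: p2) =i a :: unzip1 q.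
  by move=> b; rewrite q1 /unzip1 map_cat /= (perm_mem (catC _ _ _ _)).
have inK b : b \in a :: unzip1 q -> b \in K.
  by rewrite def_K in_set mem_p.
have [a_q uq] := andP up1.
have uhq : uniq (map (head G) (unzip1 q)).
  rewrite map_inj_in_uniq // => b c bq cq; apply: injK; apply: inK;
    by rewrite inE ?bq ?cq orbT.
have ha_q : head G a \notin map (head G) (unzip1 q).
  apply/mapP=> [[b bq hab]]; case/negP: a_q.
  by rewrite (injK a b) // inK // inE ?eqxx ?bq ?orbT.
have Kq b : b \in K :\ a -> b \in unzip1 q.
  by rewrite def_K 2!inE in_set mem_p inE => /andP[/negbTE->].
case/joinsP: join_a => [] [_ ha].
  exists (fun z => index z (y :: unzip2 q)) => b /Kq bq.
  by apply: uwalk_forward; rewrite // -ha.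
(* The walk ends at the head of [a], so positions are counted backwards. *)
exists (fun z => #|G| - index z (y :: unzip2 q)) => b /Kq bq.
have [_ hb] := uwalk_ends walk_q bq.
apply: ltn_sub2l; last by apply: uwalk_backward; rewrite // last_q -ha.
rewrite -index_mem in hb; apply: leq_trans hb _.
by rewrite -(card_uniqP up2) max_card.
Qed.

End Cycles.

(** * Comparing the optima of G and G/Z *)

Section GraphContraction.

Variables (A : finType) (G : digraph A) (Z : {set G}).
Implicit Types (x y : G) (a : A) (B D K : {set A}).

Lemma from_quot_covered D :
  from_quot (covered (contract Z) D) = covered G D :\: Z.
Proof.
apply/setP=> x; rewrite mem_from_quot inE.
have [//|xZ] := boolP (x \in Z); apply/imsetP/imsetP=> [] [a aD x_a]; exists a => //.
  exact: to_quot_inj x_a.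
by rewrite x_a.
Qed.

Lemma covered_NoneP D :
  reflect (exists2 a, a \in D & head G a \in Z) (None \in covered (contract Z) D).
Proof.
apply: (iffP imsetP) => [] [a aD aZ]; exists a => //.
  by rewrite -to_quot_eq_None eq_sym; apply/eqP.
by apply/esym/eqP; rewrite to_quot_eq_None.
Qed.

(* The composite node is inserted at level m, below all of Z; nodes of rank   *)
(* at least m are pushed up by one.                                           *)
Lemma contract_branching D r m :
    D \subset arcs G -> {in D &, injective (head G)} -> ranking r D ->
    {in Z, forall z, m <= r z} ->
    {in D, forall a, head G a \in Z -> r (tail G a) < m} ->
    {in D &, forall a b, head G a \in Z -> head G b \in Z -> head G a = head G b} ->
  branching (contract Z) D.
Proof.
move=> sDA injD rD Zm Dm hD.
have mZ x : x \in Z -> m <= r x by apply: Zm.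
have tD a : a \in D -> head G a \in Z -> r (tail G a) < m by apply: Dm.
pose r' (u : quot Z) := if u is Some x then r (val x) + (m <= r (val x)) else m.
have r'E x : r' (to_quot Z x) = if x \in Z then m else r x + (m <= r x).
  have [xZ|xZ] := boolP (x \in Z).
    by rewrite (eqP (_ : to_quot Z x == None)) ?to_quot_eq_None.
  by rewrite /to_quot insubT.
apply/branchingP; split.
- apply/subsetP=> a aD; rewrite inE (subsetP sDA) // andbT inE.
  apply/and3P=> [[_ tZ hZ]]; have := mZ _ tZ.
  by rewrite leqNgt tD.
- move=> a b aD bD /= hab; apply: injD => //.
  have [aZ|aZ] := boolP (head G a \in Z); last exact: to_quot_inj hab.
  by apply: hD; rewrite // -to_quot_eq_None -hab to_quot_eq_None.
exists r' => a aD; rewrite [tail _ a]/= [head _ a]/= !r'E.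
have ra := rD a aD; case: ifP => [/mZ mt|_]; case: ifP => [/(tD _ aD) tm|_].
- by rewrite ltnNge mt in tm.
- have mh := leq_ltn_trans mt ra.
  by rewrite (ltnW mh) addn1 ltnS ltnW.
- by rewrite (leqNgt m) tm addn0.
- rewrite -addSn leq_add //; case: (leqP m (r (tail G a))) => // mt.
  by rewrite (leq_trans mt (ltnW ra)).
Qed.

Variable I : {set {set G}}.
Hypotheses (matI : is_matroid I) (ZI : Z \in I) (Z0 : Z != set0).

(* z is a node of Z of minimum rank, so the arc of B entering z (if any) does *)
(* not start at a descendant of Z; only the arcs of B whose heads extend      *)
(* Z \ z to a large independent set are kept.                                 *)
Lemma matroid_branching_contract B : matroid_branching I B ->
  exists2 B', matroid_branching (G := contract Z) (contract_matroid I Z) B' &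
              #|B| < #|B'| + #|Z|.
Proof.
case=> brB BI; have [sBA injB [r rB]] := (branchingP G B).1 brB.
case/set0Pn: Z0 => z0 z0Z; case: (arg_minnP r z0Z) => z; rewrite -[_ z]/(z \in Z) => zZ minz.
have ZzI : Z :\ z \in I by apply: (indepS matI) ZI; apply: subsetDl.
have [Y [sYB YI leB]] := matroid_extend matI ZzI BI.
have YB : Y \subset covered G B by apply: subset_trans sYB (subsetDl _ _).
have YZ x : x \in Y -> x \in Z -> x = z.
  move=> /(subsetP sYB); rewrite !inE negb_and negbK => /andP[+ _] xZ.
  by rewrite xZ orbF => /eqP.
pose D := [set a in B | head G a \in Y].
have sDB : D \subset B by apply/subsetP=> a; rewrite inE => /andP[].
have injD := sub_in2 (subsetP sDB) injB.
have covD : covered G D = Y.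
  apply/setP=> y; apply/imsetP/idP=> [[a] | yY].
    by rewrite inE => /andP[_ +] ->.
  case/imsetP: (subsetP YB _ yY) => a aB def_y; exists a => //.
  by rewrite inE aB -def_y.
have hD a : a \in D -> head G a \in Z -> head G a = z.
  by rewrite inE => /andP[_ aY]; apply: YZ.
have brD : branching (contract Z) D.
  apply: (@contract_branching D r (r z)) => //.
  - exact: subset_trans sBA.
  - by move=> a /(subsetP sDB); apply: rB.
  - by move=> a aD aZ; rewrite -(hD a aD aZ); apply/rB/(subsetP sDB).
  - by move=> a b aD bD aZ bZ; apply: etrans (hD a aD aZ) (esym (hD b bD bZ)).
exists D; last first.
  rewrite -(card_covered brB) -(card_in_imset injD) -/(covered G D) covD.
  by rewrite (cardsD1 z Z) zZ add1n addnS ltnS addnC.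
split; first exact: brD.
apply/(contract_matroidP _ Z0); exists z; first by move=> _; exact: zZ.
rewrite from_quot_covered covD; apply: (indepS matI) YI.
(* If a kept arc enters [Z], its head is [z], so [Y] supplies the element missing from [Z :\ z]. *)
case: covered_NoneP => [[a aD aZ]|_]; last by rewrite setUC setUS ?subsetDl.
have zY : z \in Y by rewrite -(hD a aD aZ) -covD imset_f.
rewrite subUset (subset_trans (subsetDl _ _)) ?subsetUr //=.
by apply/subsetP=> x xZ; rewrite !inE xZ andbT; case: eqP => // ->; rewrite zY.
Qed.

Variable K : {set A}.
Hypotheses (cKZ : is_cycle K Z) (sKA : K \subset arcs G).
Hypothesis injK : {in K &, injective (head G)}.

Let c := Contraction I K Z.

(** The restoration phase never gets stuck: independence in the contracted matroid provides the free
    node, and the cycle has an arc into every node of [Z]. *)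
Lemma omitted_exists Bh :
    matroid_branching (G := contract Z) (contract_matroid I Z) Bh ->
  exists a, omitted c Bh a.
Proof.
case=> _ /contract_matroidP-/(_ Z0)[q qZ BI].
have enterK z : z \in Z -> exists2 a, a \in K & head G a = z.
  by rewrite -(cycle_covered cKZ injK) => /imsetP[a aK ->]; exists a.
case: covered_NoneP qZ BI => [[b bB bZ] _ _|NB /(_ isT) qZ BI].
  have [a aK ha] := enterK _ bZ; exists a; apply: (@OmitEntered _ c _ _ b) => //.
  by apply/eqP; rewrite to_quot_eq_None.
have [a aK ha] := enterK _ qZ; exists a; apply: (@OmitFree _ c _ _ q) => //.
  move=> b bB /eqP; rewrite to_quot_eq_None => bZ; apply: NB; by exists b.
rewrite from_quot_covered in BI; rewrite (_ : covered _ _ = covered G Bh :\: Z) //.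
apply/esym/setDidPl; rewrite disjoints_subset; apply/subsetP=> _ /imsetP[b bB ->].
by rewrite inE; apply/negP=> bZ; apply: NB; exists b.
Qed.

Lemma matroid_branching_restore Bh a :
    matroid_branching (G := contract Z) (contract_matroid I Z) Bh ->
    omitted c Bh a ->
  matroid_branching I (Bh :|: (K :\ a)) /\ #|Bh :|: (K :\ a)|.+1 = #|Bh| + #|Z|.
Proof.
case=> /branchingP[sBA injB [r rB]] BI om_a.
have aK : a \in K by case: om_a.
have sBG : Bh \subset arcs G by apply: subset_trans sBA (subsetDl _ _).
have disjBK b : b \in Bh -> b \notin K.
  move/(subsetP sBA); rewrite inE => /andP[bZ _]; apply: contra bZ.
  exact/subsetP/cycle_inner.
have KZ b : b \in K -> to_quot Z (head G b) = None /\ to_quot Z (tail G b) = None.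
  by case/(cycle_ends cKZ) => tZ hZ; split; apply/eqP; rewrite to_quot_eq_None.
have crossBK b k : b \in Bh -> k \in K :\ a -> head G b <> head G k.
  move=> bB; rewrite !inE => /andP[ka kK] hbk.
  have hb : to_quot Z (head G b) = None by rewrite hbk; case: (KZ k kK).
  case: om_a => [w freeB _ _ _ _|b' b'B /= hb' _ hab']; first exact: freeB bB hb.
  (* Only one arc of [Bh] enters the composite node, so [b = b'] and [k] shares its head with
     [a]. *)
  case/eqP: ka; apply: injK => //; rewrite -hbk hab'; congr (head G _).
  by apply: injB => //; apply: etrans hb (esym hb').
have cardD : #|Bh :|: (K :\ a)|.+1 = #|Bh| + #|Z|.
  rewrite -(cycle_card cKZ).1 (cardsD1 a K) aK cardsU [_ :&: _](_ : _ = set0).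
    by rewrite cards0 subn0 addnS.
  by apply/setP=> b; rewrite !inE; case: (boolP (b \in Bh)) => //= /disjBK/negbTE->;
     rewrite andbF.
split=> //; split.
  apply/branchingP; split.
  - by rewrite subUset sBG (subset_trans (subsetDl _ _)).
  - move=> b1 b2 /setUP[b1B|b1K] /setUP[b2B|b2K] h12.
    + by apply: injB => //=; rewrite h12.
    + by case: (crossBK _ _ b1B b2K).
    + by case: (crossBK _ _ b2B b1K).
    + by apply: injK h12; [move: b1K | move: b2K]; rewrite inE => /andP[].
  - have [s sK] := cycle_ranking cKZ injK aK.
    pose M := (\max_x s x).+1; have ltM x : s x < M by apply: leq_bigmax.
    (* Lexicographic order, as [M] exceeds every [s x]: [r] decides for arcs of [Bh], and [s] for
       cycle arcs, whose ends have the same image in the quotient. *)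
    exists (fun x => r (to_quot Z x) * M + s x) => b /setUP[bB|bK].
      have lt_r : r (to_quot Z (tail G b)) < r (to_quot Z (head G b)) by apply: rB.
      apply: leq_trans (leq_addr _ _); apply: leq_trans (leq_mul lt_r (leqnn M)).
      by rewrite mulSn addnC ltn_add2r.
    have bK' : b \in K by move: bK; rewrite inE => /andP[].
    by have [-> ->] := KZ b bK'; rewrite ltn_add2l; apply: sK.
have covKa : covered G (K :\ a) \subset Z :\ head G a.
  apply/subsetP=> y /imsetP[k]; rewrite !inE => /andP[ka kK] ->.
  have [_ ->] := cycle_ends cKZ kK; rewrite andbT; apply: contra ka => /eqP hka.
  by rewrite (injK kK aK hka).
rewrite /covered imsetU -!/(covered G _).
case: om_a => [w _ _ BwI _ hw|b bB hb _ hab].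
  by apply: (indepS matI) BwI; rewrite -hw /= setUS.
case/contract_matroidP: BI => // q _; case: covered_NoneP => [_|[]]; last first.
  by exists b => //; rewrite -to_quot_eq_None; apply/eqP.
rewrite from_quot_covered => BI; apply: (indepS matI) BI.
apply/subUsetP; split; apply/subsetP=> x; rewrite !in_setU.
  by rewrite inE => ->; rewrite andbT orNb.
by move/(subsetP covKa); rewrite inE => /andP[_ ->]; rewrite orbT.
Qed.

Lemma max_restore Bh a :
    max_matroid_branching (G := contract Z) (contract_matroid I Z) Bh ->
    omitted c Bh a ->
  max_matroid_branching I (Bh :|: (K :\ a)).
Proof.
case=> mbB maxB /(matroid_branching_restore mbB)[mbBa cardBa]; split=> // B.
case/matroid_branching_contract=> B' /maxB leB' ltB.
by rewrite -ltnS cardBa (leq_trans ltB) ?leq_add2r.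
Qed.

End GraphContraction.

(** * Single steps of the contraction phase *)

Section Steps.

Variables (A : finType) (s : state A).
Notation G := (st_graph s).
Notation I := (st_indep s).
Notation B := (st_arcs s).
Hypotheses (matI : is_matroid I) (mbB : matroid_branching I B).

(** A larger branching would augment C(B) by a node that it covers; such a node has an incoming arc,
    so it is a candidate. *)
Lemma stop_max :
    (forall v, v \in candidates s -> v |: covered G B \notin I) ->
  max_matroid_branching I B.
Proof.
move=> stop; split=> // B' [brB' B'I]; have [brB BI] := mbB.
rewrite leqNgt -(card_covered brB) -(card_covered brB'); apply/negP=> ltBB'.
have [y] := indep_augment matI BI B'I ltBB'.
rewrite inE => /andP[yB yB']; apply/negP/stop.
rewrite inE yB /=; apply: subsetP yB'; apply: imsetS.
by case/branchingP: brB'.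
Qed.

Variables (v : G) (a : A).
Hypothesis va : eligible v a.

Lemma eligible_arcs : a |: B \subset arcs G.
Proof.
case: va mbB => _ _ aG _ [/branchingP[sBG _ _] _].
by rewrite subUset sub1set aG.
Qed.

Lemma eligible_notin : a \notin B.
Proof.
case: va => vW _ _ hav; apply/negP=> aB; move: vW; rewrite inE -hav.
by rewrite /covered imset_f.
Qed.

Lemma eligible_inj : {in a |: B &, injective (head G)}.
Proof.
case: va mbB => vW _ _ hav [/branchingP[_ injB _] _].
have neq_a b : b \in B -> head G a <> head G b.
  move=> bB hab; move: vW; rewrite inE -hav hab.
  by rewrite /covered imset_f.
move=> b1 b2 /setU1P[->|b1B] /setU1P[->|b2B] // h12.
- by case: (neq_a _ b2B).
- by case: (neq_a _ b1B).
exact: injB.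
Qed.

Lemma eligible_indep : covered G (a |: B) \in I.
Proof. by case: va => _ vBI _ hav; rewrite /covered imsetU1 hav. Qed.

Lemma add_matroid_branching :
  acyclic G (a |: B) -> matroid_branching I (a |: B).
Proof.
move=> acB; split; last exact: eligible_indep.
apply/branchingP; split; [exact: eligible_arcs | exact: eligible_inj |].
exact: acyclic_ranking.
Qed.

Variables (K : {set A}) (Z : {set G}).
Hypotheses (cKZ : is_cycle K Z) (sKB : K \subset a |: B).

Lemma step_cycle_inj : {in K &, injective (head G)}.
Proof.
by move=> b1 b2 /(subsetP sKB) b1K /(subsetP sKB) b2K; apply: eligible_inj.
Qed.

Lemma step_cycle_arcs : K \subset arcs G.
Proof. exact: subset_trans sKB eligible_arcs. Qed.

Lemma step_cycle_covered : Z \subset covered G (a |: B).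
Proof. by rewrite -(cycle_covered cKZ step_cycle_inj); apply: imsetS. Qed.

Lemma step_cycle_indep : Z \in I.
Proof. exact: (indepS matI) step_cycle_covered eligible_indep. Qed.

(** Every node of [Z] is already entered by an arc of [K], so no remaining arc enters [Z] and the
    composite node is uncovered. *)
Lemma contract_state_branching :
  matroid_branching (G := contract Z) (contract_matroid I Z)
                    (B :\: inner_arcs Z).
Proof.
have [_ Z0] := cycle_card cKZ; case: (mbB) => /branchingP[sBG injB [r rB]] _.
have notZ b : b \in B :\: inner_arcs Z -> head G b \notin Z.
  rewrite inE => /andP[bZ bB]; apply: contra bZ.
  rewrite -{1}(cycle_covered cKZ step_cycle_inj) => /imsetP[k kK hbk].
  have -> : b = k.
    by apply: eligible_inj hbk; [rewrite inE bB orbT | apply: (subsetP sKB)].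
  exact: (subsetP (cycle_inner cKZ step_cycle_arcs)).
have sB'B := subsetDl B (inner_arcs Z).
split.
  apply: (@contract_branching _ _ _ _ r 0) => //.
  - exact: subset_trans sBG.
  - by move=> b b' /(subsetP sB'B) bB /(subsetP sB'B) b'B; apply: injB.
  - by move=> b /(subsetP sB'B); apply: rB.
  - by move=> b /notZ/negP.
  - by move=> b b' /notZ/negP bZ _ /bZ.
case/set0Pn: (Z0) => z zZ; apply/(contract_matroidP _ Z0); exists z => //.
rewrite from_quot_covered; case: covered_NoneP => [[b /notZ/negP]//|_].
apply: (indepS matI) eligible_indep; apply/subUsetP; split.
  apply: subset_trans (subsetDl _ _) _; apply: imsetS.
  by apply: subset_trans sB'B _; apply: subsetUr.
by apply: subset_trans step_cycle_covered; apply: subsetDl.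
Qed.

(** Contraction removes some j > 0 arcs from the digraph and at most j from [B]; counting the former
    twice makes the difference drop. *)
Lemma contract_state_arcs :
  #|arcs (contract Z)| + #|arcs (contract Z)| + #|B| <
  #|arcs G| + #|arcs G| + #|B :\: inner_arcs Z|.
Proof.
have /eqP E : #|arcs G :&: inner_arcs Z| == #|inner_arcs Z|.
  by rewrite (setIidPr _) //; apply/subsetP=> b; rewrite inE => /andP[].
rewrite -(cardsID (inner_arcs Z) (arcs G)) E -(cardsID (inner_arcs Z) B) /=.
set n := #|arcs G :\: _|; set j := #|inner_arcs Z|.
have j0 : 0 < j.
  have [cardK Z0] := cycle_card cKZ; apply: leq_trans (_ : #|K| <= _).
    by rewrite cardK card_gt0.
  exact/subset_leq_card/(cycle_inner cKZ)/step_cycle_arcs.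
have leBj : #|B :&: inner_arcs Z| <= j by apply/subset_leq_card/subsetIr.
rewrite addnA ltn_add2r addnACA [ltnRHS]addnC ltn_add2l.
by apply: leq_ltn_trans leBj _; rewrite -[ltnLHS]addn0 ltn_add2l.
Qed.

End Steps.

(** * Invariant, termination and progress *)

Section Executions.

Variables (A : finType) (G : digraph A) (I : {set {set G}}).
Hypothesis matI : is_matroid I.

(* [opt] is the set of arc sets known to be acceptable at the last level of   *)
(* [h].                                                                       *)
Fixpoint restorable (h : history A) (opt : {set A} -> Prop) : Prop :=
  match h with
  | [::] => forall Bh, opt Bh -> max_matroid_branching I Bh
  | None :: h' => restorable h' opt
  | Some c :: h' =>
      (forall Bh, opt Bh ->
         (exists a, omitted c Bh a) /\
         (forall a, omitted c Bh a ->
            max_matroid_branching (ct_indep c) (Bh :|: (ct_arcs c :\ a)))) /\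
      restorable h' (max_matroid_branching (ct_indep c))
  end.

(** A restoring configuration does not carry its current digraph, so the optimality predicate is
    quantified existentially. *)
Definition invariant (c : config A) : Prop :=
  match c with
  | Contracting h s =>
      [/\ is_matroid (st_indep s), matroid_branching (st_indep s) (st_arcs s)
        & restorable h (max_matroid_branching (st_indep s))]
  | Restoring h Bh => exists2 opt : {set A} -> Prop, opt Bh & restorable h opt
  end.

(* Twice the weight absorbs the growth of the history by one per step.        *)
Definition weight (c : config A) : nat :=
  match c with
  | Contracting h s =>
      (#|arcs (st_graph s)| + #|arcs (st_graph s)| - #|st_arcs s|).*2
        + (size h).+1
  | Restoring h _ => size h
  end.

Lemma invariant_start : invariant (start I).
Proof.
split=> //=; split; last by rewrite /covered imset0 (indep0 matI).
apply/branchingP; split; first exact: sub0set.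
  by move=> a b; rewrite inE.
by exists (fun=> 0) => a; rewrite inE.
Qed.

Lemma step_invariant c c' : step c c' -> invariant c -> invariant c'.
Proof.
case=> {c c'} [h s v a va ac|h s v a K Z va cKZ sKB|h s stop|h Bh|c h Bh a om_a] /=.
- case=> matI' mbB resh; split=> //.
  exact (add_matroid_branching mbB va ac).
- case=> matI' mbB resh; have [_ Z0] := cycle_card cKZ.
  have ZI := step_cycle_indep matI' mbB va cKZ sKB.
  have sKA := step_cycle_arcs mbB va sKB.
  have injK := step_cycle_inj mbB va sKB.
  split=> /=; first exact: contract_is_matroid.
    exact (contract_state_branching matI' mbB va cKZ sKB).
  split=> // Bh maxB; split; first by apply: omitted_exists => //; case: maxB.
  by move=> a'; apply: max_restore.
- by case=> matI' mbB resh; exists (max_matroid_branching (st_indep s)) => //;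
     apply: stop_max.
- by [].
- case=> opt optB [opt_h res_h]; exists (max_matroid_branching (ct_indep c)) => //.
  by case: (opt_h _ optB) => _; apply.
Qed.

Lemma step_weight c c' : step c c' -> invariant c -> weight c' < weight c.
Proof.
case=> {c c'} [h s v a va ac|h s v a K Z va cKZ sKB|h s stop|h Bh|c h Bh a om_a] //=.
- case=> matI' mbB _; have := subset_leq_card (eligible_arcs mbB va).
  rewrite cardsU1 (eligible_notin va); lia.
- case=> matI' mbB _; have := contract_state_arcs mbB va cKZ sKB.
  have := subset_leq_card (subset_trans (subsetUr _ _) (eligible_arcs mbB va)).
  have := subset_leq_card (subsetDl (st_arcs s) (inner_arcs Z)).
  by rewrite /=; lia.
- by lia.
Qed.

Lemma execution_invariant c c' : execution c c' -> invariant c -> invariant c'.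
Proof. by elim=> {c c'} // c1 c2 c3 /step_invariant inv12 _ IH /inv12/IH. Qed.

Lemma invariant_Acc c : invariant c -> Acc (fun c' c => step c c') c.
Proof.
have [n] := ubnP (weight c); elim: n c => [|n IHn] c; first by rewrite ltn0.
move=> le_n inv_c.
constructor=> c' st; apply: IHn (step_invariant st inv_c).
exact: leq_trans (step_weight st inv_c) le_n.
Qed.

Lemma invariant_progress c : invariant c ->
  (exists Bh, c = output Bh) \/ (exists c', step c c').
Proof.
case: c => [h s [matI' mbB resh]|[|[c|] h] Bh].
- right; have [[v [a va]]|stop] := classic (exists v a, @eligible _ s v a).
    have [ac|nac] := classic (acyclic (st_graph s) (a |: st_arcs s)).
      by eexists; apply: StepAdd va ac.
    have [K [Z [cKZ sKB]]] : exists K (Z : {set st_graph s}),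
        is_cycle K Z /\ K \subset a |: st_arcs s.
      apply: NNPP => nKZ; apply: nac => K Z cKZ; apply/negP=> sKB.
      by apply: nKZ; exists K, Z.
    by eexists; apply: StepContract va cKZ sKB.
  eexists; apply: StepStop => v vW; apply/negP=> vI; apply: stop.
  by move: (vW); rewrite inE => /andP[_ /imsetP[a aG hav]]; exists v, a.
- by left; exists Bh.
- case=> opt optB [/(_ _ optB)[[a om_a] _] _]; right.
  by eexists; apply: StepRestoreContract om_a.
- by right; eexists; apply: StepRestoreAdd.
Qed.

End Executions.

Theorem theorem2 (A : finType) (G : digraph A) (I : {set {set G}})
    (matI : is_matroid I) :
  [/\ (* every execution terminates *)
      Acc (fun c' c => step c c') (start I),
      (* no execution gets stuck before producing an output *)
      forall c, execution (start I) c ->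
        (exists Bh, c = output Bh) \/ (exists c', step c c')
    & (* the output of every execution is optimal *)
      forall Bh, execution (start I) (output Bh) ->
        max_matroid_branching I Bh].
Proof.
have inv0 := invariant_start matI; split.
- exact: invariant_Acc inv0.
- by move=> c /execution_invariant/(_ inv0)/invariant_progress.
- by move=> Bh /execution_invariant/(_ inv0)[opt optB]; apply.
Qed.
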